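(* For MLAPD on any rooted tree of depth $D$, the online algorithm \textsc{Waterfall} is $D$-competitive: on every instance, the total cost of its schedule is at most $D$ times the cost of an optimal schedule.
   Context: MLAPD: an instance is a rooted tree $\mathcal{T}$ with root $r$ and positive node costs $c(v)>0$, together with a set of requests $\rho=(v,a,d)$ issued at node $v$ with arrival time $a$ and deadline $d\ge a$ (deadlines distinct). A service $(S,t)$ is a subtree $S\ni r$ of $\mathcal{T}$ transmitted at time $t$, costing $c(S)=\sum_{u\in S}c(u)$; it satisfies $(v,a,d)$ if $v\in S$ and $a\le t\le d$. A feasible schedule satisfies every request; its cost is the sum of its service costs. Online: requests are revealed at arrival; the tree is known. Depth $D$: maximum number of nodes on a root-to-leaf path. $c$-competitive: cost at most $c$ times optimal on every instance. $\mathcal{T}_v$ is the subtree rooted at $v$. A request is pending at time $t$ if it has arrived by $t$ and was not satisfied by earlier transmissions. For a pending request $\rho$ in $\mathcal{T}_v$, $P(v\to\rho)$ is the node set of the path from $v$ to the node of $\rho$, $P_\rho=P(r\to\rho)$, and for a node set $S$, $P(v\to\rho\mid S)=P(v\to\rho)\setminus S$. \textsc{Waterfall}: every node $u$ carries a price $p(u)$, initialized to $c(u)$; write $p(X)=\sum_{u\in X}p(u)$. When a pending request $\rho$ reaches its deadline $t=d_\rho$: set $S=P_\rho$ and $p(v)=c(v)$ for $v\in P_\rho$; put the nodes of $P_\rho$ into a FIFO queue $Q$; while $Q\ne\emptyset$, dequeue a node $v$, run the $v$-fall on $S$ and enqueue every node it returns; finally transmit $(S,t)$. The $v$-fall: set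 $A=\emptyset$ and budget $b=c(v)$; go through the pending requests $\gamma$ in $\mathcal{T}_v$ in increasing order of deadline; for each, let $P=P(v\to\gamma\mid S)$ with the current $S$; if $p(P)>b$, replace $p(u)$ by $p(u)(1-b/p(P))$ for every $u\in P$ and stop; otherwise add $P$ to $A$ and to $S$, set $b\gets b-p(P)$, and reset $p(u)=c(u)$ for all $u\in P$. The $v$-fall returns $A$. *)

(* Defs.v *)
From HB Require Import structures.
From mathcomp Require Import all_boot all_order all_algebra.
Set Implicit Arguments. Unset Strict Implicit. Unset Printing Implicit Defensive.
Import Order.TTheory GRing.Theory Num.Theory.
Local Open Scope ring_scope.

Section MLAPD.
Variable R : realFieldType.
Variable V : finType.
Variable r : V.
Variable par : V -> V.

(* A rooted tree: the root is its own parent and every node reaches the root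
   by iterating the parent map (this rules out cycles). *)
Definition is_rooted_tree : Prop :=
  par r = r /\ forall v : V, exists n : nat, iter n par v = r.

Definition anc (u v : V) : bool := [exists n : 'I_#|V|, iter n par v == u].

(* node set of the path from u down to w (empty if w not in T_u) *)
Definition path_set (u w : V) : {set V} := [set x | anc u x && anc x w].
Definition root_path (v : V) : {set V} := [set x | anc x v].

Definition leaf (v : V) : bool := [forall w, (par w == v) ==> (w == v)].
Definition depth : nat := \max_(v | leaf v) #|root_path v|.

Definition request := (V * R * R)%type.
Definition rnode (q : request) : V := q.1.1.
Definition rarr (q : request) : R := q.1.2.
Definition rdead (q : request) : R := q.2.

(* Services: (subtree, time) *)
Definition service := ({set V} * R)%type.
Definition is_subtree (S : {set V}) : bool :=
  (r \in S) && [forall u in S, par u \in S].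
Definition satisfies (s : service) (q : request) : bool :=
  (rnode q \in s.1) && (rarr q <= s.2 <= rdead q).

Variable c : V -> R.

Definition set_cost (f : V -> R) (S : {set V}) : R := \sum_(u in S) f u.
Definition sched_cost (sched : seq service) : R :=
  \sum_(s <- sched) set_cost c s.1.

Definition feasible (reqs : seq request) (sched : seq service) : Prop :=
  (forall s, s \in sched -> is_subtree s.1) /\
  (forall q, q \in reqs -> has (fun s => satisfies s q) sched).

(* pending at time t w.r.t. the transmissions made so far (all earlier) *)
Definition pending (trans : seq service) (t : R) (q : request) : bool :=
  (rarr q <= t) && ~~ has (fun s => satisfies s q) trans.

Fixpoint vfall_loop (v : V) (l : seq request) (S : {set V}) (p : V -> R)
    (b : R) (A : {set V}) : {set V} * (V -> R) * {set V} :=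
  match l with
  | [::] => (S, p, A)
  | g :: l' =>
      let P := path_set v (rnode g) :\: S in
      let pP := set_cost p P in
      if b < pP then
        (S, (fun u => if u \in P then p u * (1 - b / pP) else p u), A)
      else
        vfall_loop v l' (S :|: P) (fun u => if u \in P then c u else p u)
          (b - pP) (A :|: P)
  end.

(* the v-fall on S; pend = pending requests sorted by increasing deadline.
   Returns (new S, new prices, A). *)
Definition vfall (pend : seq request) (v : V) (S : {set V}) (p : V -> R) :=
  vfall_loop v [seq g <- pend | anc v (rnode g)] S p (c v) set0.

Variable enq : {set V} -> seq V.  (* order in which a returned set is enqueued *)

(* FIFO queue processing; each node is enqueued at most once, so #|V|
   dequeue steps suffice. *)
Fixpoint queue_loop (pend : seq request) (n : nat) (Q : seq V) (S : {set V})
    (p : V -> R) : {set V} * (V -> R) :=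
  match n with
  | 0 => (S, p)
  | n'.+1 =>
      match Q with
      | [::] => (S, p)
      | v :: Q' =>
          let '(S1, p1, A1) := vfall pend v S p in
          queue_loop pend n' (Q' ++ enq A1) S1 p1
      end
  end.

Definition wf_step (sorted_reqs : seq request)
    (st : seq service * (V -> R)) (rho : request) : seq service * (V -> R) :=
  let '(trans, p) := st in
  let t := rdead rho in
  if pending trans t rho then
    let pend := [seq g <- sorted_reqs | pending trans t g] in
    let P := root_path (rnode rho) in
    let p0 := fun u => if u \in P then c u else p u in
    let '(S1, p1) := queue_loop pend #|V| (enq P) P p0 in
    (rcons trans (S1, t), p1)
  else (trans, p).

Definition waterfall (reqs : seq request) : seq service :=
  let sreqs := sort (fun x y : request => rdead x <= rdead y) reqs in
  (foldl (wf_step sreqs) ([::], c) sreqs).1.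

End MLAPD.

(* Main.v *)
Require Import Defs.
From HB Require Import structures.
From mathcomp Require Import all_boot all_order all_algebra.
From mathcomp Require Import zify ring lra.
Import Order.TTheory GRing.Theory Num.Theory.
Set Implicit Arguments.
Unset Strict Implicit.
Unset Printing Implicit Defensive.
Local Open Scope ring_scope.

(** Time is counted in deadlines that have passed. The services that contain a
node [v] cut the run of Waterfall into items of [v], each worth [c v]: an item
lasts from one service of [v] to the next. When a service contains [v], the fall
of [v] spends at most [c v] on the current items of strict descendants of [v],
and exactly [c v] if it leaves out a pending request below [v]. An item that
ends has been paid in full, unless its node is on the path of the request that
triggers the service ending it.

An item is good if the reference schedule serves its node while the item lasts.
It is down if it is not good and the service that starts it leaves out a pending
request below its node which becomes due before the reference schedule serves
the node again. It is up if it has an end and is neither good nor down.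

Suppose that a request below [w] is pending at a service, and that the current
item of [w] is not good. If the reference schedule does not serve [w] between
that service and the time the request is due, then it served the request before
the item started, so that the request was already pending and left out at the
start of the item, which is therefore down. Hence down items spend only on good
or down items, up items are paid only by good or up items, and an item that ends
on the path of a triggering request is good or down. So down items spend their
full cost, and up items are paid in full.

Let [d] be the depth of a node and [D] that of the tree. Payments go from a
smaller to a larger depth, so that with weights [d] for spending and [d - 1] for
receiving, the down items weigh at most as much as the good and down items that
they pay for; symmetrically for the up items with the weights [D - d + 1] and
[D - d]. Together, the items that end cost at most [D] times as much as the good
items, and distinct good items of [v] correspond to distinct services of [v] in
the reference schedule. *)

Lemma setD_chain (T : finType) (A B C : {set T}) :
  A \subset B -> B \subset C -> C :\: A = (B :\: A) :|: (C :\: B).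
Proof.
move=> AB BC.
by rewrite -{1}(setID C B) setDUl (setIidPr BC) setDDl (setUidPl AB).
Qed.

Section Tree.
Variables (V : finType) (r : V) (par : V -> V).

Lemma anc_fconnect u v : anc par u v = fconnect par v u.
Proof.
apply/existsP/idP => [[n /eqP<-]|vu]; first exact: fconnect_iter.
have lt_card : (findex par v u < #|V|)%N.
  exact: leq_trans (findex_max vu) (max_card _).
by exists (Ordinal lt_card); rewrite /= iter_findex.
Qed.

Lemma anc_refl v : anc par v v.
Proof. by rewrite anc_fconnect connect0. Qed.

Lemma anc_trans v u w : anc par u v -> anc par v w -> anc par u w.
Proof. by rewrite !anc_fconnect => uv vw; apply: connect_trans vw uv. Qed.

Lemma is_subtree_anc (X : {set V}) v w :
  is_subtree r par X -> w \in X -> anc par v w -> v \in X.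
Proof.
case/andP=> _ /forall_inP parX wX; rewrite anc_fconnect => /iter_findex <-.
by elim: findex => //= k IHk; apply: parX.
Qed.

Hypothesis tree : is_rooted_tree r par.

Lemma periodic_eq_root v : v \in fconnect par (par v) -> v = r.
Proof.
case: tree => par_r reach_r v_periodic.
have v_cycle := all_iffLR orbitPcycle 2%N 0%N v_periodic.
have [k vr] := reach_r v.
have r_orbit : r \in orbit par v by rewrite -fconnect_orbit -vr fconnect_iter.
have := in_orbit par v; rewrite -(fconnect_cycle v_cycle r_orbit).
by move/iter_findex <-; elim: findex => //= j ->.
Qed.

Lemma anc_antisym u v : anc par u v -> anc par v u -> u = v.
Proof.
rewrite !anc_fconnect => vu uv; have [//|neq_uv] := eqVneq u v.
have step x y : x != y -> fconnect par x y -> fconnect par (par x) y.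
  by move=> neq_xy; rewrite fconnect_eqVf (negPf neq_xy).
have periodic x y : x != y -> fconnect par x y -> fconnect par y x -> x = r.
  move=> neq_xy xy yx; apply: periodic_eq_root.
  exact: connect_trans (step _ _ neq_xy xy) yx.
by rewrite (periodic u v) // (periodic v u) // eq_sym.
Qed.

Lemma root_path_card_gt0 v : (0 < #|root_path par v|)%N.
Proof. by apply/card_gt0P; exists v; rewrite inE anc_refl. Qed.

Lemma root_path_card_lt u v :
  anc par u v -> u != v -> (#|root_path par u| < #|root_path par v|)%N.
Proof.
move=> uv neq_uv; apply: proper_card; apply/properP; split.
  by apply/subsetP => z; rewrite !inE => zu; apply: anc_trans zu uv.
exists v; rewrite inE ?anc_refl //.
by apply: contraNN neq_uv => vu; rewrite (anc_antisym uv vu).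
Qed.

Lemma root_path_card_le_depth v : (#|root_path par v| <= depth par)%N.
Proof.
pose u := [arg max_(u > v) #|root_path par u|].
have u_max w : (#|root_path par w| <= #|root_path par u|)%N.
  by rewrite /u; case: arg_maxnP => // i _; apply.
apply: leq_trans (u_max v) _.
apply: (@leq_bigmax_cond _ _ (fun w => #|root_path par w|)).
apply/forallP => w; apply/implyP => /eqP par_w; apply: contraT => neq_wu.
have uw : anc par u w by rewrite anc_fconnect -par_w fconnect1.
by have := root_path_card_lt uw; rewrite eq_sym neq_wu ltnNge u_max => /(_ isT).
Qed.

End Tree.

Section Falls.
Variables (R : realFieldType) (V : finType) (par : V -> V) (c : V -> R).
Implicit Types (S F P : {set V}) (p y : V -> R).
Implicit Types (q : request R V) (l pend : seq (request R V)).
Hypothesis c_gt0 : forall v, 0 < c v.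

Definition reset S p (u : V) : R := if u \in S then c u else p u.

Lemma reset_ge0 S p w : (forall u, 0 <= p u) -> 0 <= reset S p w.
Proof. by move=> p_ge0; rewrite /reset; case: ifP => // _; apply: ltW. Qed.

(* [y w] is spent on [w] while the service grows from [S] to [S'] and the prices
   change from [p] to [p']; the price of a bought node is reset. *)
Record payment S p S' p' y : Prop := {
  payment_sub : S \subset S';
  payment_old : forall w, w \in S -> y w = 0 /\ p' w = p w;
  payment_bought : forall w, w \in S' :\: S -> y w = p w /\ p' w = c w;
  payment_unserved : forall w, w \notin S' -> y w = p w - p' w;
  payment_price_ge0 : forall w, 0 <= p' w }.

Lemma eq_payment S p S' p' y y' :
  y =1 y' -> payment S p S' p' y -> payment S p S' p' y'.
Proof.
by move=> yy' [? old bought unserved ?]; split=> // w; rewrite -yy'; auto.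
Qed.

Lemma payment0 S p : (forall w, 0 <= p w) -> payment S p S p (fun=> 0).
Proof. by move=> p_ge0; split=> // w; rewrite ?setDv ?inE // subrr. Qed.

Lemma payment_buy S p P : (forall w, 0 <= p w) -> [disjoint P & S] ->
  payment S p (S :|: P) (reset P p) (fun w => (w \in P)%:R * p w).
Proof.
move=> p_ge0 disPS; split=> [|w|w|w|w]; first exact: subsetUl.
- by move=> wS; rewrite /reset (disjointFl disPS wS) mul0r.
- by rewrite !inE /reset; case: (w \in S) => //= ->; rewrite mul1r.
- by rewrite inE negb_or /reset => /andP[_ /negPf->]; rewrite mul0r subrr.
- exact: reset_ge0.
Qed.

Lemma payment_discount S p P (t : R) :
  (forall w, 0 <= p w) -> [disjoint P & S] -> t <= 1 ->
  payment S p S (fun u => if u \in P then p u * (1 - t) else p u)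
    (fun w => (w \in P)%:R * (p w * t)).
Proof.
move=> p_ge0 disPS t_le1; split=> // [w wS|w|w wS|w].
- by rewrite (disjointFl disPS wS) mul0r.
- by rewrite setDv inE.
- by case: (w \in P); rewrite ?mul0r ?mul1r; ring.
- by case: ifP => // _; rewrite mulr_ge0 // subr_ge0.
Qed.

Lemma payment_trans S p S1 p1 y S2 p2 z :
  payment S p S1 p1 y -> payment S1 p1 S2 p2 z ->
  payment S p S2 p2 (fun w => y w + z w).
Proof.
move=> [sub1 old1 bought1 unserved1 _] [sub2 old2 bought2 unserved2 ge0].
split=> // [|w wS|w|w wS2]; first exact: subset_trans sub2.
- have [-> <-] := old1 w wS.
  by have [-> ->] := old2 w (subsetP sub1 w wS); rewrite addr0.
- rewrite inE => /andP[wS wS2]; have [wS1|wS1] := boolP (w \in S1).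
    have [-> ->] := old2 w wS1; rewrite addr0.
    by apply: bought1; rewrite inE wS.
  have /bought2[-> ->] : w \in S2 :\: S1 by rewrite inE wS1.
  by rewrite unserved1 // subrK.
- rewrite unserved2 // unserved1 ?addrA ?subrK //.
  by apply: contraNN wS2; apply: (subsetP sub2).
Qed.

Definition left_out S (v : V) q : bool :=
  anc par v (rnode q) && (rnode q \notin S).

Lemma sub_left_out S S' v q :
  S \subset S' -> left_out S' v q -> left_out S v q.
Proof.
move=> subS /andP[vq qS']; rewrite /left_out vq; apply: contraNN qS'.
exact: (subsetP subS).
Qed.

(* [y] is how the fall of [v] spends the budget [b] on the requests of [l] when
   the service is [S'] afterwards. *)
Record account (v : V) (b : R) l S' y : Prop := {
  account_ge0 : forall w, 0 <= y w;
  account_le : \sum_w y w <= b;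
  account_full : forall q : request R V,
    q \in l -> left_out S' v q -> \sum_w y w = b;
  account_support : forall w, y w != 0 -> [/\ anc par v w, v != w &
    exists2 q : request R V, q \in l & anc par w (rnode q) /\
      forall q' : request R V,
        q' \in l -> left_out S' v q' -> rdead q <= rdead q'] }.

Definition fall (v : V) (b : R) l S p S' p' : Prop :=
  exists2 y, payment S p S' p' y & account v b l S' y.

Lemma sub_account v b l S S' y :
  S \subset S' -> account v b l S y -> account v b l S' y.
Proof.
move=> subS [ge0 le_b full support].
split=> // [q ql /(sub_left_out subS)|w]; first exact: full.
case/support=> vw neq_vw [q ql [wq q_first]].
split=> //; exists q => //; split=> // q' q'l /(sub_left_out subS).
exact: q_first.
Qed.

Lemma account_filter v b l S' y :
  account v b [seq q <- l | anc par v (rnode q)] S' y -> account v b l S' y.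
Proof.
have mem_below q : q \in l -> left_out S' v q ->
    q \in [seq q <- l | anc par v (rnode q)].
  by move=> ql /andP[vq _]; rewrite mem_filter vq.
case=> ge0 le_b full support; split=> // [q ql lq|w].
  exact: full (mem_below q ql lq) lq.
case/support=> vw neq_vw [q]; rewrite mem_filter => /andP[_ ql] [wq q_first].
split=> //; exists q => //; split=> // q' q'l lq'.
by apply: q_first => //; apply: mem_below.
Qed.

Definition by_deadline (q q' : request R V) : bool := rdead q <= rdead q'.

Lemma by_deadline_trans : transitive by_deadline.
Proof. by move=> q q1 q2; apply: le_trans. Qed.

Lemma sum_indicator P p : \sum_w (w \in P)%:R * p w = set_cost p P.
Proof.
rewrite /set_cost [RHS]big_mkcond; apply: eq_bigr => w _.
by rewrite mulr_natl mulrb.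
Qed.

Lemma fall_nil v b S p :
  (forall w, 0 <= p w) -> 0 <= b -> fall v b [::] S p S p.
Proof.
move=> p_ge0 b_ge0; exists (fun=> 0); first exact: payment0.
by split=> // [|w]; rewrite ?big1 // eqxx.
Qed.

Section FallStep.
Variables (v : V) (q : request R V) (l : seq (request R V)) (S : {set V}).
Variables (p : V -> R) (b : R).
Hypothesis (vS : v \in S) (p_ge0 : forall w, 0 <= p w) (b_ge0 : 0 <= b).
Hypothesis q_first : forall q', q' \in q :: l -> rdead q <= rdead q'.

Local Notation P := (path_set par v (rnode q) :\: S).

Lemma new_path_disjoint : [disjoint P & S].
Proof. by rewrite -setI_eq0 setIDAC setDIl setDv setI0. Qed.

Lemma mem_new_path w :
  w \in P -> [/\ anc par v w, v != w & anc par w (rnode q)].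
Proof.
rewrite !inE => /and3P[wS -> ->]; split=> //.
by apply: contraNneq wS => <-.
Qed.

Lemma fall_stop : b < set_cost p P -> fall v b (q :: l) S p S
  (fun u => if u \in P then p u * (1 - b / set_cost p P) else p u).
Proof.
move=> lt_b; have cost_gt0 : 0 < set_cost p P by apply: le_lt_trans lt_b.
exists (fun w => (w \in P)%:R * (p w * (b / set_cost p P))).
  apply: payment_discount new_path_disjoint _ => //.
  by rewrite ler_pdivrMr // mul1r ltW.
have sum_b : \sum_w (w \in P)%:R * (p w * (b / set_cost p P)) = b.
  by rewrite sum_indicator /set_cost -mulr_suml mulrC divfK // gt_eqF.
split=> [w|||w].
- by rewrite !mulr_ge0 // invr_ge0 ltW.
- by rewrite sum_b.
- by rewrite sum_b.
have [/mem_new_path[vw neq_vw wq] _|_] := boolP (w \in P); last first.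
  by rewrite mul0r eqxx.
split=> //; exists q; first exact: mem_head.
by split=> // q' q'l _; apply: q_first.
Qed.

Lemma fall_buy S' p' :
  anc par v (rnode q) ->
  fall v (b - set_cost p P) l (S :|: P) (reset P p) S' p' ->
  fall v b (q :: l) S p S' p'.
Proof.
move=> vq [z pay_z [z_ge0 z_le z_full z_support]].
exists (fun w => (w \in P)%:R * p w + z w).
  exact: payment_trans (payment_buy p_ge0 new_path_disjoint) pay_z.
have qS' : rnode q \in S'.
  apply: (subsetP (payment_sub pay_z)).
  by rewrite !inE vq anc_refl; case: (_ \in S).
have mem_left q' : q' \in q :: l -> left_out S' v q' -> q' \in l.
  by rewrite inE => /predU1P[->|//]; rewrite /left_out qS' andbF.
have sumE : \sum_w ((w \in P)%:R * p w + z w) = set_cost p P + \sum_w z w.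
  by rewrite big_split /= sum_indicator.
split=> [w||q' q'l lq'|w].
- by rewrite addr_ge0 // mulr_ge0.
- by rewrite sumE addrC -lerBrDr.
- by rewrite sumE (z_full q') // ?mem_left // addrC subrK.
have [/mem_new_path[vw neq_vw wq] _|_] := boolP (w \in P).
  split=> //; exists q; first exact: mem_head.
  by split=> // q' q'l _; apply: q_first.
rewrite mul0r add0r => /z_support[vw neq_vw [q1 q1l [wq1 q1_first]]].
split=> //; exists q1; first by rewrite inE q1l orbT.
by split=> // q' q'l lq'; apply: q1_first => //; apply: mem_left.
Qed.

End FallStep.

Lemma vfall_loopP v l S p b A :
  v \in S -> sorted by_deadline l ->
  (forall q, q \in l -> anc par v (rnode q)) ->
  (forall w, 0 <= p w) -> 0 <= b ->
  let: (S', p', A') := vfall_loop par c v l S p b A in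
  A' = A :|: (S' :\: S) /\ fall v b l S p S' p'.
Proof.
elim: l S p b A => [|q l IHl] S p b A vS l_sorted below p_ge0 b_ge0 /=.
  by split; [rewrite setDv setU0 | exact: fall_nil].
have q_first q' : q' \in q :: l -> rdead q <= rdead q'.
  rewrite inE => /predU1P[->//|].
  by move/allP: (order_path_min by_deadline_trans l_sorted); apply.
case: ifPn => [lt_b|]; last rewrite -leNgt => le_b.
  by split; [rewrite setDv setU0 | exact: fall_stop].
set P := path_set par v (rnode q) :\: S in le_b *.
have := IHl (S :|: P) (reset P p) (b - set_cost p P) (A :|: P).
rewrite -/(reset P p); case: vfall_loop => [[S' p'] A'] /(_ _ _ _ _ _)[].
- by rewrite inE vS.
- exact: path_sorted l_sorted.
- by move=> q' q'l; apply: below; rewrite inE q'l orbT.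
- by move=> w; apply: reset_ge0.
- by rewrite subr_ge0.
move=> -> fall_l; split; last first.
  by apply: fall_buy => //; apply: below; rewrite mem_head.
have [y /payment_sub sub_SP _] := fall_l; rewrite -setUA.
rewrite (setD_chain (subsetUl S P) sub_SP) setDUl setDv set0U.
by rewrite (setDidPl (new_path_disjoint _ _ _)).
Qed.

Lemma vfallP pend v S p :
  v \in S -> sorted by_deadline pend -> (forall w, 0 <= p w) ->
  let: (S', p', A) := vfall par c pend v S p in
  A = S' :\: S /\ fall v (c v) pend S p S' p'.
Proof.
move=> vS pend_sorted p_ge0; rewrite /vfall.
have := @vfall_loopP v [seq q <- pend | anc par v (rnode q)] S p (c v) set0.
case: vfall_loop => [[S' p'] A] /(_ vS _ _ p_ge0 _)[].
- exact: sorted_filter by_deadline_trans _ _ pend_sorted.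
- by move=> q; rewrite mem_filter => /andP[].
- exact: ltW.
rewrite set0U => -> [y pay_y acc_y]; split=> //.
by exists y => //; apply: account_filter.
Qed.

(* [F] is the set of nodes whose fall is run, and [x v w] is what the fall of
   [v] spends on [w]. *)
Record ledger pend F S p S' p' (x : V -> V -> R) : Prop := {
  ledger_payment : payment S p S' p' (fun w => \sum_v x v w);
  ledger_account : forall v, v \in F -> account v (c v) pend S' (x v);
  ledger_idle : forall v w, v \notin F -> x v w = 0 }.

Lemma ledger0 pend S p :
  (forall w, 0 <= p w) -> ledger pend set0 S p S p (fun _ _ => 0).
Proof.
move=> p_ge0; split=> // [|v]; last by rewrite inE.
by apply: eq_payment (payment0 S p_ge0) => w; rewrite big1.
Qed.

Lemma ledger_fall pend F v S p S1 p1 y S' p' x :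
  v \notin F -> payment S p S1 p1 y -> account v (c v) pend S1 y ->
  ledger pend F S1 p1 S' p' x ->
  ledger pend (v |: F) S p S' p' (fun u => if u == v then y else x u).
Proof.
move=> vF pay_y acc_y [pay_x acc_x idle]; split=> [|u|u w].
- apply: eq_payment (payment_trans pay_y pay_x) => w.
  rewrite (bigD1 v) //= idle // add0r [RHS](bigD1 v) //= eqxx.
  by congr (_ + _); apply: eq_bigr => u /negPf->.
- rewrite in_setU1; case: eqP => [-> _|_] /=; last exact: acc_x.
  exact: sub_account (payment_sub pay_x) acc_y.
- by rewrite in_setU1; case: eqP => //= _; apply: idle.
Qed.

Variable enq : {set V} -> seq V.
Hypothesis enqP : forall X : {set V}, perm_eq (enq X) (enum X).

Lemma mem_enq X v : (v \in enq X) = (v \in X).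
Proof. by rewrite (perm_mem (enqP X)) mem_enum. Qed.

Lemma queue_loop_ledger pend n (Q : seq V) S p :
  sorted by_deadline pend -> (forall w, 0 <= p w) ->
  uniq Q -> {subset Q <= S} -> (size Q + #|~: S| <= n)%N ->
  let: (S', p') := queue_loop par c enq pend n Q S p in
  exists x, ledger pend ([set v in Q] :|: (S' :\: S)) S p S' p' x.
Proof.
move=> pend_sorted.
have no_fall S1 p1 : (forall w, 0 <= p1 w) ->
    exists x, ledger pend ([set v in [::]] :|: (S1 :\: S1)) S1 p1 S1 p1 x.
  by exists (fun _ _ => 0); rewrite set_nil setDv setU0; apply: ledger0.
elim: n Q S p => [|n IHn] Q S p p_ge0 Q_uniq QS /=.
  by case: Q Q_uniq QS => // _ _ _; apply: no_fall.
case: Q Q_uniq QS => [_ _ _|v Q]; first exact: no_fall.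
rewrite cons_uniq => /andP[vQ Q_uniq] QS size_le.
have vS : v \in S by apply: QS; rewrite mem_head.
have QS' w : w \in Q -> w \in S by move=> wQ; apply: QS; rewrite inE wQ orbT.
have := vfallP vS pend_sorted p_ge0.
case: vfall => [[S1 p1] A] [-> [y pay_y acc_y]] {A}.
have sub1 := payment_sub pay_y.
have := IHn (Q ++ enq (S1 :\: S)) S1 p1 (payment_price_ge0 pay_y).
case: queue_loop => [S' p'] /(_ _ _ _)[].
- rewrite cat_uniq Q_uniq (perm_uniq (enqP _)) enum_uniq andbT /=.
  apply/hasPn => w; rewrite mem_enq inE => /andP[wS _].
  by apply: contraNN wS => /QS'.
- move=> w; rewrite mem_cat mem_enq inE => /orP[/QS'|/andP[]//].
  exact: (subsetP sub1).
- rewrite size_cat (perm_size (enqP _)) -cardE cardsDS //.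
  have := cardsC S; have := cardsC S1; have := subset_leq_card sub1.
  by move: size_le => /=; lia.
move=> x ledger_x; exists (fun u => if u == v then y else x u).
have sub' := payment_sub (ledger_payment ledger_x).
have -> : [set u in v :: Q] :|: (S' :\: S)
    = v |: ([set u in Q ++ enq (S1 :\: S)] :|: (S' :\: S1)).
  rewrite (setD_chain sub1 sub') set_cons -setUA; congr (_ |: _).
  by apply/setP => u; rewrite !inE mem_cat mem_enq inE orbA.
apply: ledger_fall pay_y acc_y ledger_x.
by rewrite !inE mem_cat mem_enq !inE vS (negPf vQ) (subsetP sub1).
Qed.

Lemma service_ledger pend C p :
  sorted by_deadline pend -> (forall w, 0 <= p w) ->
  let: (S', p') := queue_loop par c enq pend #|V| (enq C) C (reset C p) in
  exists x, ledger pend S' C (reset C p) S' p' x.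
Proof.
move=> pend_sorted p_ge0.
have := @queue_loop_ledger pend #|V| (enq C) C (reset C p) pend_sorted.
case: queue_loop => [S' p'] /(_ _ _ _ _)[].
- by move=> w; apply: reset_ge0.
- by rewrite (perm_uniq (enqP _)) enum_uniq.
- by move=> w; rewrite mem_enq.
- by rewrite (perm_size (enqP _)) -cardE cardsC.
move=> x ledger_x; exists x.
have /setIidPr CS' := payment_sub (ledger_payment ledger_x).
have enqC : [set v in enq C] = C by apply/setP => v; rewrite inE mem_enq.
by rewrite enqC -{1}CS' setID in ledger_x.
Qed.

End Falls.

Lemma ler_sum_transport (R : realFieldType) (I J : finType) (x : I -> J -> R)
    (f : I -> R) (g : J -> R) :
  (forall i j, 0 <= x i j) -> (forall i j, x i j != 0 -> f i <= g j) ->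
  \sum_i f i * (\sum_j x i j) <= \sum_j g j * (\sum_i x i j).
Proof.
move=> x_ge0 fg; under eq_bigr do rewrite mulr_sumr.
under [leRHS]eq_bigr do rewrite mulr_sumr.
rewrite exchange_big /=; apply: ler_sum => j _; apply: ler_sum => i _.
by have [->|/fg fg_ij] := eqVneq (x i j) 0; rewrite ?mulr0 // ler_wpM2r.
Qed.

(* [T i] is the [i]-th service and [C i] the path of the request that triggers
   it. Item [0] of a node lasts until its first service, and item [i.+1], which
   exists for the nodes of [T i], lasts from service [i] to the next one. *)
Section Items.
Variables (R : realFieldType) (V : finType) (par : V -> V) (c : V -> R).
Variables (n : nat) (T C : nat -> {set V}) (p : nat -> V -> R).
Variables (pend : nat -> seq (request R V)) (x : 'I_n -> V -> V -> R).

Implicit Types f g h : nat -> V -> R.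

Definition item (j : nat) (w : V) : bool :=
  if j is i.+1 then w \in T i else true.

Fixpoint current_item (i : nat) (w : V) : nat :=
  if i is i'.+1 then if w \in T i' then i else current_item i' w else 0%N.

Lemma current_item_le i w : (current_item i w <= i)%N.
Proof. by elim: i => //= i IHi; case: ifP => // _; apply: leqW. Qed.

Lemma current_item_eq i k w :
  (current_item i w <= k <= i)%N -> current_item k w = current_item i w.
Proof.
elim: i => [|i IHi] /=; first by rewrite leqn0 => /eqP->.
case: ifPn => [wT|wT]; first by rewrite -eqn_leq => /eqP<- /=; rewrite wT.
rewrite (leq_eqVlt k) => /andP[le_k /predU1P[->|lt_k]].
  by rewrite /= (negPf wT).
by rewrite IHi // le_k.
Qed.

Lemma current_item_gt i m w :
  w \in T i -> (i < m)%N -> (i < current_item m w)%N.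
Proof.
move=> wT lt_im; rewrite ltnNge; apply/negP => le_i.
have := @current_item_eq m i.+1 w.
by rewrite /= wT (leqW le_i) lt_im => /(_ isT) iE; rewrite -iE ltnn in le_i.
Qed.

Lemma sum_items_by_end (g : nat -> R) m w :
  \sum_(j < m.+1 | item j w) g j =
  \sum_(i < m | w \in T i) g (current_item i w) + g (current_item m w).
Proof.
elim: m => [|m IHm].
  by rewrite big_ord0 add0r big_mkcond big_ord1.
rewrite big_mkcond big_ord_recr -big_mkcond IHm /=.
rewrite [in RHS]big_mkcond [in RHS]big_ord_recr -[in RHS]big_mkcond /=.
by case: ifP => _; rewrite ?addr0.
Qed.

Definition weight g : R :=
  \sum_w \sum_(j < n.+1 | item j w) g j w * c w.

Lemma weightE g : weight g =
  \sum_w g 0%N w * c w + \sum_(i < n) \sum_(v in T i) g i.+1 v * c v.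
Proof.
rewrite (exchange_big_dep predT) //= -big_split; apply: eq_bigr => w _ /=.
by rewrite big_mkcond big_ord_recl -big_mkcond.
Qed.

Lemma weightD g h : weight (fun j w => g j w + h j w) = weight g + weight h.
Proof.
rewrite -big_split; apply: eq_bigr => w _; rewrite -big_split.
by apply: eq_bigr => j _; rewrite mulrDl.
Qed.

Lemma weightZ a g : weight (fun j w => a * g j w) = a * weight g.
Proof.
rewrite /weight mulr_sumr; apply: eq_bigr => w _; rewrite mulr_sumr.
by apply: eq_bigr => j _; rewrite mulrA.
Qed.

Lemma weightB g h : weight (fun j w => g j w - h j w) = weight g - weight h.
Proof.
rewrite -sumrB; apply: eq_bigr => w _; rewrite -sumrB.
by apply: eq_bigr => j _; rewrite mulrBl.
Qed.

Hypothesis c_gt0 : forall v, 0 < c v.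

Lemma ler_weight g h :
  (forall (j : 'I_n.+1) w, item j w -> g j w <= h j w) -> weight g <= weight h.
Proof.
move=> gh; apply: ler_sum => w _; apply: ler_sum => j jw.
by apply: ler_wpM2r; [exact: ltW | exact: gh].
Qed.

Lemma weight_ended_items :
  weight (fun j w => (j != current_item n w)%:R) =
  \sum_(i < n) set_cost c (T i).
Proof.
rewrite /set_cost (exchange_big_dep predT) //=; apply: eq_bigr => w _.
rewrite (sum_items_by_end (fun j => (j != current_item n w)%:R * c w)).
rewrite eqxx mul0r addr0; apply: eq_bigr => i wT.
rewrite ltn_eqF ?mul1r //.
exact: leq_ltn_trans (current_item_le i w) (current_item_gt wT _).
Qed.

Hypothesis price0 : p 0%N = c.
Hypothesis ledgers : forall i : 'I_n,
  ledger par c (pend i) (T i) (C i) (reset c (C i) (p i)) (T i) (p i.+1) (x i).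

Lemma price_served i w : (i < n)%N -> w \in T i -> p i.+1 w = c w.
Proof.
move=> lt_in wT; have pay := ledger_payment (ledgers (Ordinal lt_in)).
have [wC|wC] := boolP (w \in C i).
  by have [_ ->] := payment_old pay wC; rewrite /reset wC.
by have [] := payment_bought pay (w := w); rewrite // inE wC.
Qed.

Lemma price_ge0 i w : (i <= n)%N -> 0 <= p i w.
Proof.
case: i => [|i] lt_in; first by rewrite price0 ltW.
exact: payment_price_ge0 (ledger_payment (ledgers (Ordinal lt_in))) w.
Qed.

Lemma payments_received (i : 'I_n) w :
  \sum_v x i v w + (w \in C i)%:R * p i w =
  p i w - (w \notin T i)%:R * p i.+1 w.
Proof.
have pay := ledger_payment (ledgers i); have subCT := payment_sub pay.
have [wT|wT] := boolP (w \in T i); last first.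
  have wC : w \notin C i by apply: contraNN wT; apply: (subsetP subCT).
  rewrite (payment_unserved pay wT) /reset (negPf wC) /=; ring.
have [wC|wC] := boolP (w \in C i).
  by have [-> _] := payment_old pay wC; rewrite /=; ring.
have [|-> _] := payment_bought pay (w := w); first by rewrite inE wC.
by rewrite /reset (negPf wC) /=; ring.
Qed.

Lemma sum_items_by_payment (g : nat -> R) m w : (m <= n)%N ->
  \sum_(j < m.+1 | item j w) g j * c w =
  \sum_(i < m) g (current_item i w) * (p i w - (w \notin T i)%:R * p i.+1 w)
    + g (current_item m w) * p m w.
Proof.
elim: m => [|m IHm] le_mn.
  by rewrite big_mkcond big_ord1 big_ord0 price0 add0r.
rewrite big_mkcond big_ord_recr -big_mkcond (IHm (ltnW le_mn)).
rewrite [in RHS]big_ord_recr /=.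
by case: (boolP (w \in T m)) => [/price_served->|_] //=; ring.
Qed.

Lemma weight_payments g :
  weight g = \sum_(i < n) \sum_w g (current_item i w) w *
      (\sum_v x i v w + (w \in C i)%:R * p i w)
    + \sum_w g (current_item n w) w * p n w.
Proof.
rewrite exchange_big -big_split; apply: eq_bigr => w _ /=.
rewrite (sum_items_by_payment (g^~ w)) //; congr (_ + _).
by apply: eq_bigr => i _; rewrite payments_received.
Qed.

Lemma spending_ge0 (i : 'I_n) v w : 0 <= x i v w.
Proof.
have [vT|vT] := boolP (v \in T i); last by rewrite (ledger_idle (ledgers i)).
exact: account_ge0 (ledger_account (ledgers i) vT) w.
Qed.

Lemma spending_le (i : 'I_n) v : \sum_w x i v w <= (v \in T i)%:R * c v.
Proof.
have [vT|vT] := boolP (v \in T i); first rewrite mul1r.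
  exact: account_le (ledger_account (ledgers i) vT).
by rewrite mul0r big1 // => w _; rewrite (ledger_idle (ledgers i)).
Qed.

Lemma spending_support (i : 'I_n) v w : x i v w != 0 ->
  [/\ v \in T i, anc par v w, v != w &
    exists2 q : request R V, q \in pend i & anc par w (rnode q) /\
      forall q' : request R V,
        q' \in pend i -> left_out par (T i) v q' -> rdead q <= rdead q'].
Proof.
move=> xvw; have vT : v \in T i.
  by apply: contraNT xvw => /(ledger_idle (ledgers i))->.
by have [] := account_support (ledger_account (ledgers i) vT) xvw.
Qed.

Lemma weight_spent_le f g :
  (forall w, f 0%N w = 0) -> (forall j w, 0 <= g j w) ->
  (forall (i : 'I_n) v, v \in T i -> f i.+1 v != 0 -> \sum_w x i v w = c v) ->
  (forall (i : 'I_n) v w, x i v w != 0 -> f i.+1 v <= g (current_item i w) w) ->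
  weight f <= weight g.
Proof.
move=> f0 g_ge0 f_full fg.
rewrite (weightE f) (weight_payments g) big1 ?add0r; last first.
  by move=> w _; rewrite f0 mul0r.
apply: ler_wpDr; first by apply: sumr_ge0 => w _; rewrite mulr_ge0 ?price_ge0.
apply: ler_sum => i _; have price_i_ge0 w : 0 <= p i w by apply/price_ge0/ltnW.
apply: le_trans (_ : \sum_v f i.+1 v * (\sum_w x i v w) <= _).
  rewrite big_mkcond; apply: ler_sum => v _; have [vT|vT] := boolP (v \in T i).
    by have [->|/f_full->] := eqVneq (f i.+1 v) 0; rewrite ?mul0r.
  by rewrite big1 ?mulr0 // => w _; apply: (ledger_idle (ledgers i)).
apply: le_trans (ler_sum_transport (spending_ge0 i) (fg i)) _.
by apply: ler_sum => w _; rewrite ler_wpM2l // lerDl mulr_ge0.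
Qed.

Lemma weight_paid_le f g :
  (forall j w, 0 <= f j w) -> (forall w, g (current_item n w) w = 0) ->
  (forall (i : 'I_n) w, w \in C i -> g (current_item i w) w = 0) ->
  (forall (i : 'I_n) v w, x i v w != 0 -> g (current_item i w) w <= f i.+1 v) ->
  weight g <= weight f.
Proof.
move=> f_ge0 g_last g_trigger gf.
rewrite (weightE f) (weight_payments g) [X in _ + X]big1 ?addr0; last first.
  by move=> w _; rewrite g_last mul0r.
apply: ler_wpDl.
  by apply: sumr_ge0 => w _; apply: mulr_ge0; [exact: f_ge0 | exact: ltW].
apply: ler_sum => i _.
apply: le_trans (_ : \sum_w g (current_item i w) w * (\sum_v x i v w) <= _).
  apply: ler_sum => w _; have [/g_trigger->|_] := boolP (w \in C i).
    by rewrite !mul0r.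
  by rewrite mul0r addr0.
apply: le_trans (ler_sum_transport (x := fun w v => x i v w) _ _) _.
- by move=> w v; apply: spending_ge0.
- by move=> w v; apply: gf.
rewrite [leRHS]big_mkcond; apply: ler_sum => v _.
apply: le_trans (ler_wpM2l (f_ge0 _ _) (spending_le i v)) _.
by case: ifP; rewrite ?mul1r ?mul0r ?mulr0.
Qed.

End Items.

Section Run.
Variables (R : realFieldType) (V : finType) (r : V) (par : V -> V) (c : V -> R).
Variables (enq : {set V} -> seq V) (reqs : seq (request R V)).
Implicit Types (q : request R V) (trans : seq (service R V)).

Local Notation n := (size reqs).

Definition req (i : nat) : request R V := nth (r, 0, 0) reqs i.

(* Waterfall transmits at deadlines only, so that of a time [t] only the number
   of earlier deadlines matters: step [i] takes place before [t] if and only if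
   [i < clock t]. *)
Definition clock (t : R) : nat := count (fun q => rdead q < t) reqs.

Definition due q : nat := clock (rdead q).

Lemma clock_homo (t t' : R) : t <= t' -> (clock t <= clock t')%N.
Proof. by move=> le_t; apply: sub_count => q /= /lt_le_trans; apply. Qed.

Hypothesis reqs_sorted : sorted <%O [seq rdead q | q <- reqs].

Lemma due_req i : (i < n)%N -> due (req i) = i.
Proof.
move=> lt_in; rewrite /due /req -(nth_map _ 0) //.
rewrite -[RHS](count_lt_nth 0 reqs_sorted) ?size_map //.
by rewrite count_map.
Qed.

Lemma clock_leq t i : (i < n)%N -> (clock t <= i)%N = (t <= rdead (req i)).
Proof.
move=> lt_in; case: leP => [le_t|lt_t].
  by rewrite -[leqRHS](due_req lt_in) clock_homo.
apply/negbTE; rewrite -ltnNge.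
rewrite -(count_le_nth 0 reqs_sorted) ?size_map // count_map.
rewrite (nth_map (r, 0, 0)) //.
by apply: sub_count => q /= /le_lt_trans; apply.
Qed.

Lemma clock_leq_due t q : q \in reqs -> (clock t <= due q)%N = (t <= rdead q).
Proof.
by move=> /(nthP (r, 0, 0))[i lt_in <-]; rewrite (due_req lt_in) clock_leq.
Qed.

Definition run (i : nat) : seq (service R V) * (V -> R) :=
  foldl (wf_step par c enq reqs) ([::], c) (take i reqs).

Definition sent (i : nat) : seq (service R V) := (run i).1.

Definition price (i : nat) : V -> R := (run i).2.

Definition triggered (i : nat) : bool :=
  pending (sent i) (rdead (req i)) (req i).

Definition pend (i : nat) : seq (request R V) :=
  [seq q <- reqs | pending (sent i) (rdead (req i)) q].

Definition trigger_path (i : nat) : {set V} :=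
  if triggered i then root_path par (rnode (req i)) else set0.

Definition outcome (i : nat) : {set V} * (V -> R) :=
  if triggered i then
    queue_loop par c enq (pend i) #|V| (enq (trigger_path i)) (trigger_path i)
      (reset c (trigger_path i) (price i))
  else (set0, price i).

Definition served (i : nat) : {set V} := (outcome i).1.

Lemma runS i : (i < n)%N -> run i.+1 =
  (if triggered i then rcons (sent i) (served i, rdead (req i)) else sent i,
   (outcome i).2).
Proof.
move=> lt_in; rewrite /run (take_nth (r, 0, 0)) // foldl_rcons -/(run i).
rewrite -/(req i) /served /outcome /trigger_path /triggered /pend /sent /price.
case: (run i) => trans p /=; case: ifP => // _.
by rewrite /reset; case: queue_loop.
Qed.

Lemma sched_cost_sent i :
  (i <= n)%N -> sched_cost c (sent i) = \sum_(k < i) set_cost c (served k).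
Proof.
elim: i => [|i IHi] le_in.
  by rewrite /sent /run take0 /sched_cost big_ord0 big_nil.
rewrite big_ord_recr -(IHi (ltnW le_in)) /sent runS // /served /outcome /=.
case: (triggered i); last by rewrite /set_cost big_set0 addr0.
by rewrite /sched_cost -cats1 big_cat big_seq1.
Qed.

Definition satisfied trans q : bool := has (fun s => satisfies s q) trans.

Lemma satisfied_sent_le q i j : (i <= j <= n)%N ->
  satisfied (sent i) q -> satisfied (sent j) q.
Proof.
elim: j => [|j IHj]; first by rewrite leqn0 => /andP[/eqP->].
rewrite leq_eqVlt => /andP[/predU1P[->//|lt_ij] lt_jn] sat_i.
have sat_j : satisfied (sent j) q by apply: IHj; rewrite // -ltnS lt_ij ltnW.
rewrite /sent runS //=; case: ifP => // _.
by rewrite /satisfied has_rcons [has _ _]sat_j orbT.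
Qed.

Lemma satisfied_served i q : (i < n)%N -> rnode q \in served i ->
  rarr q <= rdead (req i) <= rdead q -> satisfied (sent i.+1) q.
Proof.
move=> lt_in q_served q_time; rewrite /sent runS //=.
case: ifPn => [_|not_trig].
  by rewrite /satisfied has_rcons /satisfies q_served q_time.
by move: q_served; rewrite /served /outcome (negPf not_trig) inE.
Qed.

Hypothesis c_gt0 : forall v, 0 < c v.
Hypothesis enqP : forall X : {set V}, perm_eq (enq X) (enum X).

Definition step_ledger (i : nat) : (V -> V -> R) -> Prop :=
  ledger par c (pend i) (served i) (trigger_path i)
    (reset c (trigger_path i) (price i)) (served i) (price i.+1).

Lemma step_ledger_exists i : (i < n)%N -> (forall w, 0 <= price i w) ->
  exists x, step_ledger i x.
Proof.
move=> lt_in price_i.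
rewrite /step_ledger /price runS //= -/(price i) /served /outcome.
have [trig|not_trig] := boolP (triggered i).
  have pend_sorted : sorted (@by_deadline R V) (pend i).
    apply: sorted_filter (@by_deadline_trans R V) _ _ _.
    by case/lt_sorted_is_uniq_le/andP: reqs_sorted => _; rewrite sorted_map.
  have := service_ledger par c_gt0 enqP (trigger_path i) pend_sorted price_i.
  by case: queue_loop.
exists (fun _ _ => 0); rewrite /trigger_path (negPf not_trig) /=.
have reset0 : reset c set0 (price i) =1 price i by move=> w; rewrite /reset inE.
split=> [|v|//]; last by rewrite inE.
split=> // [w|w|w _]; rewrite ?setDv ?inE //.
by rewrite reset0 big1 ?subrr.
Qed.

Lemma run_price0 : price 0 = c.
Proof. by rewrite /price /run take0. Qed.

Lemma run_price_ge0 i w : (i <= n)%N -> 0 <= price i w.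
Proof.
elim: i w => [|i IHi] w lt_in; first by rewrite run_price0 ltW.
have [x ledger_x] := step_ledger_exists lt_in (fun u => IHi u (ltnW lt_in)).
exact: payment_price_ge0 (ledger_payment ledger_x) w.
Qed.

Lemma run_ledgers :
  exists x : 'I_n -> V -> V -> R, forall i : 'I_n, step_ledger i (x i).
Proof.
have step_i (i : 'I_n) : exists x, step_ledger i x.
  by apply: step_ledger_exists => // w; apply/run_price_ge0/ltnW.
exact: fin_all_exists step_i.
Qed.

Hypothesis arr_le : forall q, q \in reqs -> rarr q <= rdead q.

Lemma satisfied_req i : (i < n)%N -> satisfied (sent i.+1) (req i).
Proof.
move=> lt_in; have req_time : rarr (req i) <= rdead (req i).
  by apply: arr_le; apply: mem_nth.
have [trig|not_trig] := boolP (triggered i).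
  have price_i w : 0 <= price i w by apply/run_price_ge0/ltnW.
  have [x ledger_x] := step_ledger_exists lt_in price_i.
  have /subsetP path_served := payment_sub (ledger_payment ledger_x).
  apply: satisfied_served => //; last by rewrite req_time /=.
  by apply: path_served; rewrite /trigger_path trig inE anc_refl.
apply: (@satisfied_sent_le _ i); first by rewrite leqnSn.
by move: not_trig; rewrite /triggered /pending req_time negbK.
Qed.

Lemma mem_pend i q : (i < n)%N -> (q \in pend i) =
  [&& q \in reqs, (clock (rarr q) <= i)%N & ~~ satisfied (sent i) q].
Proof. by move=> lt_in; rewrite mem_filter clock_leq // andbC. Qed.

Lemma pend_due i q : (i < n)%N -> q \in pend i -> (i <= due q)%N.
Proof.
move=> lt_in; rewrite mem_pend // => /and3P[/(nthP (r, 0, 0))[k lt_kn <-] _].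
rewrite (due_req lt_kn) leqNgt; apply: contra => lt_ki.
by apply: satisfied_sent_le (satisfied_req lt_kn); rewrite lt_ki ltnW.
Qed.

Lemma pend_earlier i j q : (j < i < n)%N -> q \in pend i ->
  (clock (rarr q) <= j)%N -> q \in pend j /\ rnode q \notin served j.
Proof.
case/andP=> lt_ji lt_in q_pend arr_j; have lt_jn := ltn_trans lt_ji lt_in.
have le_due := pend_due lt_in q_pend.
move: q_pend; rewrite !mem_pend // arr_j => /and3P[q_reqs _ unsat_i].
split.
  rewrite q_reqs; apply: contra unsat_i; apply: satisfied_sent_le.
  by rewrite (ltnW lt_ji) (ltnW lt_in).
apply: contra unsat_i => q_served.
apply: (@satisfied_sent_le _ j.+1); first by rewrite lt_ji ltnW.
apply: satisfied_served => //; rewrite -clock_leq // arr_j -clock_leq_due //.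
by rewrite [clock _](due_req lt_jn) (leq_trans (ltnW lt_ji)).
Qed.

End Run.

Lemma sum_has_le (R : realFieldType) (A : Type) (P : pred A) (f : A -> nat)
    (s : seq A) (m : nat) :
  \sum_(j < m) (has (fun a => P a && (f a == j)) s)%:R <=
  \sum_(a <- s) (P a)%:R :> R.
Proof.
elim: s => [|a s IHs]; first by rewrite big1 ?big_nil.
rewrite big_cons; apply: le_trans (lerD (lexx _) IHs).
have le_Pa : \sum_(j < m) (P a && (f a == j))%:R <= (P a)%:R :> R.
  case: (P a) => /=; last by rewrite big1.
  have [lt_m|le_m] := ltnP (f a) m; last first.
    by rewrite big1 // => j _; rewrite gtn_eqF // (leq_trans _ le_m).
  rewrite (bigD1 (Ordinal lt_m)) //= eqxx big1 ?addr0 // => j.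
  by rewrite -val_eqE eq_sym /= => /negPf->.
apply: le_trans (lerD le_Pa (lexx _)); rewrite -big_split /=.
apply: ler_sum => j _; rewrite -natrD ler_nat.
by case: (P a && _); case: has.
Qed.

Section Charging.
Variables (R : realFieldType) (V : finType) (r : V) (par : V -> V) (c : V -> R).
Variables (enq : {set V} -> seq V) (reqs : seq (request R V)).
Variables (sched : seq (service R V)).

Local Notation n := (size reqs).
Local Notation clock := (clock reqs).
Local Notation due := (due reqs).
Local Notation T := (served r par c enq reqs).
Local Notation pend := (pend r par c enq reqs).
Local Notation cur := (current_item T).
Implicit Types (P : pred nat) (q : request R V).

Definition serves_when P (v : V) : bool :=
  has (fun s : service R V => (v \in s.1) && P (clock s.2)) sched.

Definition good (j : nat) (v : V) : bool :=
  serves_when (fun k => cur k v == j) v.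

Definition down (j : nat) (v : V) : bool :=
  ~~ good j v &&
  if j is i.+1 then
    has (fun q => left_out par (T i) v q &&
                  ~~ serves_when (fun k => i < k <= due q)%N v) (pend i)
  else false.

Definition up (j : nat) (v : V) : bool :=
  [&& ~~ good j v, ~~ down j v & j != cur n v].

Lemma sub_serves_when P P' v :
  subpred P P' -> serves_when P v -> serves_when P' v.
Proof. by move=> PP'; apply: sub_has => s /andP[-> /PP']. Qed.

Lemma serves_whenU P P' v :
  serves_when (predU P P') v = serves_when P v || serves_when P' v.
Proof. by rewrite -has_predU; apply: eq_has => s /=; rewrite -andb_orr. Qed.

Hypothesis feas : feasible r par reqs sched.

Lemma serves_when_anc P v w :
  anc par v w -> serves_when P w -> serves_when P v.
Proof.
move=> vw /hasP[s s_sched /andP[ws Ps]]; apply/hasP; exists s => //.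
by rewrite (is_subtree_anc (feas.1 s s_sched) ws vw).
Qed.

Lemma serves_request q : q \in reqs ->
  serves_when (fun k => clock (rarr q) <= k <= due q)%N (rnode q).
Proof.
move/(feas.2 q)/hasP=> [s s_sched /and3P[qs arr_s s_due]].
by apply/hasP; exists s; rewrite // qs !clock_homo.
Qed.

Hypothesis reqs_sorted : sorted <%O [seq rdead q | q <- reqs].
Hypothesis c_gt0 : forall v, 0 < c v.
Hypothesis enqP : forall X : {set V}, perm_eq (enq X) (enum X).
Hypothesis arr_le : forall q, q \in reqs -> rarr q <= rdead q.

Lemma item_good_or_down i w q :
  (i < n)%N -> q \in pend i -> anc par w (rnode q) ->
  ~~ serves_when (fun k => i < k <= due q)%N w ->
  good (cur i w) w || down (cur i w) w.
Proof.
move=> lt_in q_pend wq unserved_after.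
have [//|not_good] := boolP (good _ _); rewrite /= /down not_good.
have unserved : ~~ serves_when (fun k => cur i w <= k <= due q)%N w.
  apply: contraNN not_good => served_since.
  suff: serves_when (predU (fun k => cur k w == cur i w)
                           (fun k => i < k <= due q)%N) w.
    by rewrite serves_whenU (negPf unserved_after) orbF.
  apply: sub_serves_when _ served_since => k /andP[item_k k_due] /=.
  case: ltnP => [_|le_ki]; first by rewrite k_due orbT.
  by rewrite (current_item_eq (i := i)) ?item_k ?eqxx.
have lt_arr : (clock (rarr q) < cur i w)%N.
  rewrite ltnNge; apply: contraNN unserved => le_arr.
  have q_reqs : q \in reqs by move: q_pend; rewrite mem_filter => /andP[].
  apply: sub_serves_when _ (serves_when_anc wq (serves_request q_reqs)) => k.
  by case/andP=> /(leq_trans le_arr)-> ->.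
have := current_item_le T i w.
case: (cur i w) lt_arr unserved => // j le_arr_j unserved lt_ji.
have [q_pend_j q_left] : q \in pend j /\ rnode q \notin T j.
  by apply: pend_earlier q_pend _ => //; rewrite lt_ji.
by apply/hasP; exists q; rewrite // /left_out wq q_left.
Qed.

Variable x : 'I_n -> V -> V -> R.
Hypothesis ledgers : forall i : 'I_n, step_ledger r par c enq reqs i (x i).

Lemma spending_edge (i : 'I_n) v w : x i v w != 0 ->
  exists2 q, (forall q', q' \in pend i -> left_out par (T i) v q' ->
                (due q <= due q')%N) &
    [|| serves_when (fun k => i < k <= due q)%N v, good (cur i w) w
      | down (cur i w) w].
Proof.
case/(spending_support ledgers)=> _ vw _ [q q_pend [wq q_first]].
exists q => [q' q'_pend /(q_first _ q'_pend)|]; first exact: clock_homo.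
have [//|v_unserved] := boolP (serves_when _ _).
apply: item_good_or_down wq _ => //.
by apply: contra v_unserved; apply: serves_when_anc.
Qed.

Lemma down_spends_all (i : 'I_n) v :
  v \in T i -> down i.+1 v -> \sum_w x i v w = c v.
Proof.
move=> vT /andP[_ /hasP[q q_pend /andP[q_left _]]].
exact: (account_full (ledger_account (ledgers i) vT) q_pend q_left).
Qed.

Lemma down_spends_on_good_or_down (i : 'I_n) v w :
  x i v w != 0 -> down i.+1 v -> good (cur i w) w || down (cur i w) w.
Proof.
case/spending_edge=> q q_first served_or /andP[_ /hasP[q' q'_pend]].
case/andP=> q'_left v_unserved; case/orP: served_or => // v_served.
case/negP: v_unserved; apply: sub_serves_when _ v_served => k /andP[-> le_k] /=.
exact: leq_trans le_k (q_first q' q'_pend q'_left).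
Qed.

Lemma up_paid_by_good_or_up (i : 'I_n) v w :
  x i v w != 0 -> up (cur i w) w -> good i.+1 v || up i.+1 v.
Proof.
case/spending_edge=> q q_first served_or /and3P[w_not_good w_not_down _].
move: served_or; rewrite (negPf w_not_good) (negPf w_not_down) !orbF.
move=> v_served.
have [//|not_good] := boolP (good _ _); rewrite /= /up not_good /=.
apply/andP; split.
  rewrite /down not_good /=; apply/hasPn => q' q'_pend.
  apply/negP=> /andP[/(q_first q' q'_pend) le_due /negP[]].
  by apply: sub_serves_when _ v_served => k /andP[-> /leq_trans]; apply.
apply: contra not_good => /eqP iE.
apply: sub_has _ v_served => s /and3P[-> lt_is _] /=.
by rewrite iE (current_item_eq (i := n)) // -iE lt_is count_size.
Qed.

Lemma trigger_path_good_or_down (i : 'I_n) w :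
  w \in trigger_path r par c enq reqs i -> good (cur i w) w || down (cur i w) w.
Proof.
rewrite /trigger_path; case: ifP => [trig|_]; rewrite inE // => w_anc.
apply: item_good_or_down w_anc _ => //.
  by rewrite mem_filter -/(triggered r par c enq reqs i) trig mem_nth.
rewrite due_req //; apply/hasPn => s _.
by rewrite andbC; case: ltngtP.
Qed.

Local Notation weight := (weight c n T).

Lemma weight_good_le : weight (fun j v => (good j v)%:R) <= sched_cost c sched.
Proof.
rewrite /sched_cost /set_cost; under [leRHS]eq_bigr do rewrite big_mkcond.
rewrite [leRHS]exchange_big; apply: ler_sum => w _.
have -> : \sum_(s <- sched) (if w \in s.1 then c w else 0) =
    (\sum_(s <- sched) (w \in s.1)%:R) * c w.
  by rewrite mulr_suml; apply: eq_bigr => s _; rewrite mulr_natl mulrb.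
rewrite -mulr_suml; apply: ler_wpM2r; first exact: ltW.
apply: le_trans (sum_has_le R (fun s : service R V => w \in s.1)
  (fun s => cur (clock s.2) w) sched n.+1).
by rewrite big_mkcond; apply: ler_sum => j _; case: ifP.
Qed.

Hypothesis tree : is_rooted_tree r par.
Local Notation level v := #|root_path par v|.

Lemma level_sub1_ge0 v : 0 <= (level v)%:R - 1 :> R.
Proof. by rewrite subr_ge0 ler1n root_path_card_gt0. Qed.

Lemma depth_sub_level_ge0 v : 0 <= (depth par)%:R - (level v)%:R :> R.
Proof. by rewrite subr_ge0 ler_nat (root_path_card_le_depth tree). Qed.

Lemma spending_level i v w :
  x i v w != 0 -> (level v)%:R + 1 <= (level w)%:R :> R.
Proof.
case/(spending_support ledgers)=> _ vw neq_vw _.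
by rewrite natr1 ler_nat (root_path_card_lt tree).
Qed.

Lemma weight_down_le :
  weight (fun j v => (down j v)%:R * (level v)%:R) <=
  weight (fun j v => (good j v || down j v)%:R * ((level v)%:R - 1)).
Proof.
apply: (weight_spent_le c_gt0 (run_price0 par c enq reqs) ledgers).
- by move=> w; rewrite /down andbF mul0r.
- by move=> j w; rewrite mulr_ge0 // level_sub1_ge0.
- move=> i v vT; case: (boolP (down _ _)) => [v_down _|_].
    exact: down_spends_all.
  by rewrite mul0r eqxx.
move=> i v w xvw; have [v_down|_] := boolP (down _ _).
  rewrite (down_spends_on_good_or_down xvw v_down) !mul1r.
  by rewrite lerBrDr (spending_level xvw).
by rewrite mul0r mulr_ge0 // level_sub1_ge0.
Qed.

Lemma weight_up_le :
  weight (fun j v => (up j v)%:R * ((depth par)%:R - (level v)%:R + 1)) <=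
  weight (fun j v => (good j v || up j v)%:R * ((depth par)%:R - (level v)%:R)).
Proof.
apply: (weight_paid_le c_gt0 (run_price0 par c enq reqs) ledgers).
- by move=> j w; rewrite mulr_ge0 // depth_sub_level_ge0.
- by move=> w; rewrite /up eqxx !andbF mul0r.
- move=> i w /trigger_path_good_or_down; rewrite /up.
  by case/orP=> ->; rewrite ?andbF mul0r.
move=> i v w xvw; have [w_up|_] := boolP (up _ _).
  rewrite (up_paid_by_good_or_up xvw w_up) !mul1r.
  by have := spending_level xvw; lra.
by rewrite mul0r mulr_ge0 // depth_sub_level_ge0.
Qed.

(* The two sides of [weight_down_le], and those of [weight_up_le], differ by one
   on down, respectively up, items; on good items the right-hand sides add up to
   [depth par - 1]. *)
Theorem run_competitive :
  sched_cost c (sent par c enq reqs n) <= (depth par)%:R * sched_cost c sched.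
Proof.
rewrite (sched_cost_sent r) // -(weight_ended_items c n T).
apply: le_trans (ler_wpM2l (ler0n _ _) weight_good_le); rewrite -weightZ.
have gap := lerD weight_down_le weight_up_le.
rewrite -!weightD -subr_ge0 -weightB in gap; rewrite -subr_ge0 -weightB.
apply: le_trans gap _; apply: (ler_weight c_gt0) => j w _; rewrite /up.
have [j_good|j_not_good] := boolP (good j w).
  by rewrite /down j_good /=; case: eqP => _ /=; lra.
by case: (down j w) => /=; case: eqP => _ /=; lra.
Qed.

End Charging.

Theorem mainTheorem6 (R : realFieldType) (V : finType) (r : V) (par : V -> V)
    (c : V -> R) (enq : {set V} -> seq V) (reqs : seq (request R V)) :
  is_rooted_tree r par ->
  (forall v, 0 < c v) ->
  (forall q, q \in reqs -> rarr q <= rdead q) ->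
  uniq [seq rdead q | q <- reqs] ->
  (forall X : {set V}, perm_eq (enq X) (enum X)) ->
  forall sched : seq (service R V),
    feasible r par reqs sched ->
    sched_cost c (waterfall par c enq reqs)
      <= (depth par)%:R * sched_cost c sched.
Proof.
move=> tree c_gt0 arr_le dead_uniq enqP sched [subtree_sched all_satisfied].
rewrite /waterfall; set sreqs := sort _ reqs.
have mem_sreqs : sreqs =i reqs by move=> q; rewrite mem_sort.
have sreqs_sorted : sorted <%O [seq rdead q | q <- sreqs].
  by rewrite -[map _ _]sort_map sort_lt_sorted.
have arr_le_sreqs q : q \in sreqs -> rarr q <= rdead q.
  by rewrite mem_sreqs; apply: arr_le.
have feas : feasible r par sreqs sched.
  by split=> // q; rewrite mem_sreqs; apply: all_satisfied.
have [x ledgers] := run_ledgers r par sreqs_sorted c_gt0 enqP.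
have := run_competitive feas sreqs_sorted c_gt0 enqP arr_le_sreqs
  ledgers tree.
by rewrite /sent /run take_size.
Qed.
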